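(* Let $Z$ be a centered Gaussian vector in $\mathbb{R}^d$ with covariance $A$. For $j=1,\dots,m$, let $G_j$ be independent gamma random variables with shape $\alpha_j>0$ and scale $\beta_j>0$, independent also of $Z$, and let $v_j\in\mathbb{R}^d$. Put $$X=Z+\sum_{j=1}^m v_j(G_j-\alpha_j\beta_j).$$ Then $$K_X(t)=\tfrac12t^\top A t+\sum_{j=1}^m\alpha_j\left[-\log(1-\beta_j\langle t,v_j\rangle)-\beta_j\langle t,v_j\rangle\right]$$ on the domain $$D_X=\{t\in\mathbb{R}^d:\beta_j\langle t,v_j\rangle<1\text{ for }j=1,\dots,m\}.$$ For every $t\in\mathbb{R}^d$, $$C_X(t)=\max_{1\le j\le m}\bigl(\beta_j\langle t,v_j\rangle\bigr)_+=p_{D_X}(t).$$ Equivalently, if $P=\operatorname{conv}\{0,\beta_1v_1,\dots,\beta_mv_m\}$, then $C_X=h_P$, the support function $h_P(t)=\sup_{x\in P}\langle t,x\rangle$ of $P$.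
   Context: For a centered infinitely divisible random vector $X$ in $\mathbb{R}^d$ with finite second moment and covariance matrix $\Sigma$, put $K_X(t):=\log\mathbb{E}e^{\langle t,X\rangle}$ (value $+\infty$ allowed) and $V_X(t):=t^\top\Sigma t$. $D_X$ denotes the interior of the effective domain $\{t:K_X(t)<\infty\}$, and, when $0\in D_X$, $p_{D_X}(t)=\inf\{a>0:t\in aD_X\}$ is its Minkowski functional. Write $z_+=\max\{z,0\}$. Directional (radial) pole: if $V_X(t)>0$, $C_X(t)\in[0,\infty]$ is the infimum of all $c\in[0,\infty)$ such that $$K_X(st)\le\frac{V_X(t)s^2}{2(1-cs)}\qquad\text{for all }0\le s<1/c,$$ with $1/0=\infty$ and $\inf\emptyset=\infty$. If $V_X(t)=0$, $C_X(t):=0$. *)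

(* Defs.v *)
From HB Require Import structures.
From mathcomp Require Import all_boot all_order all_algebra.
From mathcomp Require Import all_classical all_reals all_analysis.

Set Implicit Arguments.
Unset Strict Implicit.
Unset Printing Implicit Defensive.

Import Order.TTheory GRing.Theory Num.Theory.
Import numFieldNormedType.Exports.

Local Open Scope classical_set_scope.
Local Open Scope ring_scope.

(* Vectors of R^d are row vectors, so <u, v> = u v^T and t^T S t is
   written t S t^T. *)
Definition dotp (R : realType) (d : nat) (u v : 'rV[R]_d) : R :=
  (u *m v^T) 0 0.

Definition qform (R : realType) (d : nat) (S : 'M[R]_d) (t : 'rV[R]_d) : R :=
  (t *m S *m t^T) 0 0.

(* R^d with its Borel sigma-algebra; the carrier is convertible to 'rV[R]_d. *)
Notation borel_rV R d := (g_sigma_algebraType (@open 'rV[R]_d)).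

Section distributions.
Context {disp : measure_display} {T : measurableType disp} {R : realType}.
Variable P : probability T R.
Local Notation mu := (@lebesgue_measure R).

(* The normal law N(m, s^2), degenerate for s = 0 (where the library's
   normal_prob is uniform on [0, 1]). *)
Definition normal_law (m s : R) (B : set R) : \bar R :=
  if s == 0 then \d_m B else normal_prob m s B.

Definition is_normal (Y : T -> R) : Prop :=
  exists m s : R, 0 <= s /\
    forall B : set R, measurable B -> P (Y @^-1` B) = normal_law m s B.

Definition gaussian_vector (d : nat) (Z : T -> 'rV[R]_d) : Prop :=
  forall t : 'rV[R]_d, is_normal (fun w => dotp t (Z w)).

Definition Gamma (a : R) : R :=
  \int[mu]_(x in `]0, +oo[) (x `^ (a - 1) * expR (- x)).

Definition gamma_pdf (a b x : R) : R :=
  if 0 < x then x `^ (a - 1) * expR (- (x / b)) / (Gamma a * b `^ a) else 0.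

Definition is_gamma (a b : R) (Y : T -> R) : Prop :=
  forall B : set R, measurable B ->
    P (Y @^-1` B) = (\int[mu]_(x in B) (gamma_pdf a b x)%:E)%E.

Definition sigma_of (disp' : measure_display) (T' : measurableType disp')
    (Y : T -> T') : set (set T) :=
  preimage_set_system setT Y measurable.

Definition independent_systems (I : finType) (F : I -> set (set T)) : Prop :=
  forall (J : {set I}) (E : I -> set T), (forall i, F i (E i)) ->
    P (\bigcap_(i in [set` J]) E i) = (\prod_(i in J) P (E i))%E.

End distributions.

Section random_vectors.
Context {disp : measure_display} {T : measurableType disp} {R : realType}.
Context {d : nat}.
Variables (P : probability T R) (X : T -> 'rV[R]_d).

Definition centered : Prop := forall i, ('E_P[(fun w => X w 0 i)%R] = 0)%E.

Definition covmx : 'M[R]_d :=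
  \matrix_(i, j) fine (covariance P (fun w => X w 0 i) (fun w => X w 0 j)).

Definition cumulant (t : 'rV[R]_d) : \bar R :=
  lne ('E_P[(fun w => expR (dotp t (X w)))%R])%E.

Definition varform (t : 'rV[R]_d) : R := qform covmx t.

Definition cumulant_domain : set 'rV[R]_d :=
  interior [set t | (cumulant t < +oo)%E].

(* The inverse in [c%:E^-1] is that of \bar R, for which 0^-1 = +oo;
   ereal_inf set0 = +oo. *)
Definition radial_pole (t : 'rV[R]_d) : \bar R :=
  if 0 < varform t then
    ereal_inf [set c%:E | c in [set c : R | 0 <= c /\
      forall s : R, 0 <= s -> (s%:E < c%:E^-1)%E ->
        (cumulant (s *: t)
          <= (varform t * s ^+ 2 / (2 * (1 - c * s)))%:E)%E]]
  else 0%E.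

End random_vectors.

Section convex_geometry.
Context {R : realType} {d : nat}.

Definition minkowski_functional (D : set 'rV[R]_d) (t : 'rV[R]_d) : \bar R :=
  ereal_inf [set a%:E | a in
    [set a : R | 0 < a /\ [set a *: x | x in D] t]].

Definition convex_hull (S : set 'rV[R]_d) : set 'rV[R]_d :=
  smallest (@convex_set R 'rV[R]_d) S.

Definition support_function (S : set 'rV[R]_d) (t : 'rV[R]_d) : \bar R :=
  ereal_sup [set (dotp t x)%:E | x in S].

End convex_geometry.

(* Main.v *)
(* Put x_j(t) = beta_j <t, v_j>. Independence factorises the moment generating
   function of X, which gives K_X explicitly where all x_j < 1. If some x_j(t) >= 1,
   finiteness at t would bound the explicit formula on the segment from 0 towards t,
   but it blows up at the pole of that ray; hence K_X = +oo there. The variance V_X(t)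
   is read off from K_X(r t) = r^2 V_X(t) / 2 + O(r^3).
   For y <= c with 0 <= c < 1 one has - ln (1 - y) - y <= y^2 / (2 (1 - c)); applied
   to y = s x_j and summed, this shows that max_j (x_j)_+ is admissible in the
   definition of C_X(t). A smaller c is not, as K_X(s t) = +oo at s = 1 / x_j < 1 / c. *)
Require Import Defs.
From HB Require Import structures.
From mathcomp Require Import all_boot all_order all_algebra.
From mathcomp Require Import all_classical all_reals all_analysis.
From mathcomp Require Import measurable_realfun ring lra.

Set Implicit Arguments.
Unset Strict Implicit.
Unset Printing Implicit Defensive.

Import Order.TTheory GRing.Theory Num.Theory.
Import numFieldNormedType.Exports.

Local Open Scope classical_set_scope.
Local Open Scope ring_scope.

(** * Real analysis *)

Section exp_ln_bounds.
Context {R : realType}.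
Implicit Types x y u : R.

(** The covariance matrix is defined by integrals, while only moment generating functions are
    computable. The variance is therefore recovered without differentiating under the integral: both
    sides of E exp (r Y) = exp (k r) are expanded with cubic errors on a two-sided interval around
    0. The two endpoints of that interval supply an integrable majorant for every moment needed, and
    the two signs of r separate the mean from the second moment. The same scalar argument identifies
    the mean and variance of the Gaussian marginals, which the definition leaves unspecified.
    Independence is assumed for events, so the product formula for expectations has to be built up
    from indicators. In the admissibility of the pole, the Gaussian part costs nothing, because 1 <=
    1 / (1 - c s). *)

Lemma ge0_is_derive_le (f f' : R -> R) (a b : R) : a <= b ->
  (forall x, a <= x <= b -> is_derive x 1 f (f' x)) ->
  (forall x, a <= x <= b -> 0 <= f' x) -> f a <= f b.
Proof.
move=> ab df f'0.
have df' x : x \in `]a, b[ -> is_derive x 1 f (f' x).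
  by rewrite in_itv/= => /andP[ax xb]; apply: df; rewrite !ltW.
apply: (@ger0_derive1_le_cc _ f a b) => //.
- by move=> x /df' [].
- move=> x xab; rewrite derive1E (@derive_val _ _ _ _ _ _ _ (df' _ xab)).
  by move: xab; rewrite in_itv/= => /andP[ax xb]; apply: f'0; rewrite !ltW.
- apply: derivable_within_continuous => x; rewrite in_itv/= => xab.
  by case: (df x xab).
- by rewrite in_itv/= lexx ab.
- by rewrite in_itv/= lexx ab.
Qed.

Lemma le0_is_derive_le (f f' : R -> R) (a b : R) : a <= b ->
  (forall x, a <= x <= b -> is_derive x 1 f (f' x)) ->
  (forall x, a <= x <= b -> f' x <= 0) -> f b <= f a.
Proof.
move=> ab df f'0; rewrite -lerN2.
apply: (@ge0_is_derive_le (- f) (- f') a b) => // x xab.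
- by have := df _ xab => dfx; apply: is_deriveN.
- by rewrite oppr_ge0 f'0.
Qed.

(** Multiply [1 - x <= expR (- x)] by [expR x * (1 + x)], which is nonnegative. *)
Lemma expR_taylor1_ub x : 0 <= x -> expR x - 1 - x <= x ^+ 2 * expR x.
Proof.
move=> x0; have := expR_ge1Dx (- x); have := expR_gt0 x.
have : expR x * expR (- x) = 1 by rewrite expRN divff// gt_eqF ?expR_gt0.
move: (expR x) (expR (- x)) => e e' ee' e0 h.
have : 0 <= e * (e' - (1 - x)) * (1 + x).
  by apply: mulr_ge0; [apply: mulr_ge0|]; lra.
have -> : e * (e' - (1 - x)) * (1 + x) = (e * e') * (1 + x) - e + e * x ^+ 2.
  by ring.
by rewrite ee'; lra.
Qed.

(** The remainder has derivative [expR z - 1 - z >= 0] and vanishes at 0, so it has the sign of [x];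
    the next lemma is the other half. *)
Lemma expR_taylor2_le0 x : x <= 0 -> expR x - 1 - x - x ^+ 2 / 2 <= 0.
Proof.
move=> x0.
have := @ge0_is_derive_le (fun z => expR z - 1 - z - z ^+ 2 / 2)
  (fun z => expR z - 1 - z) _ _ x0.
rewrite expR0 expr0n/= mul0r !subr0 subrr; apply => z _.
  by apply: is_derive_eq; rewrite /GRing.scale/=; lra.
by have := expR_ge1Dx z; lra.
Qed.

Lemma expR_taylor2_ge0 x : 0 <= x -> 0 <= expR x - 1 - x - x ^+ 2 / 2.
Proof.
move=> x0.
have := @ge0_is_derive_le (fun z => expR z - 1 - z - z ^+ 2 / 2)
  (fun z => expR z - 1 - z) _ _ x0.
rewrite expR0 expr0n/= mul0r !subr0 subrr; apply => z _.
  by apply: is_derive_eq; rewrite /GRing.scale/=; lra.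
by have := expR_ge1Dx z; lra.
Qed.

(** For [x >= 0], the difference of the two sides is nondecreasing by [expR_taylor1_ub]. For
    [x <= 0], the remainder minus [x ^+ 3] is nonincreasing and vanishes at 0, so the remainder lies
    between [x ^+ 3] and 0. *)
Lemma expR_taylor2 x :
  `|expR x - 1 - x - x ^+ 2 / 2| <= `|x| ^+ 3 * expR `|x|.
Proof.
have [x0|/ltW x0] := leP 0 x.
  rewrite !ger0_norm ?expR_taylor2_ge0//.
  have := @ge0_is_derive_le
    (fun z => z ^+ 3 * expR z - (expR z - 1 - z - z ^+ 2 / 2))
    (fun z => (3 * z ^+ 2 + z ^+ 3) * expR z - (expR z - 1 - z)) _ _ x0.
  rewrite expR0 !expr0n/= !mul0r !subr0 subrr ?subr0 => h; rewrite -subr_ge0; apply: h.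
    move=> z _; apply: is_derive_eq; rewrite /GRing.scale/=.
    by rewrite !(expr2, exprS); lra.
  move=> z /andP[z0 _]; have := expR_taylor1_ub z0.
  have : 0 <= (2 * z ^+ 2 + z ^+ 3) * expR z.
    by rewrite mulr_ge0 ?expR_ge0// addr_ge0// ?mulr_ge0// exprn_ge0.
  by rewrite !mulrDl; lra.
rewrite !ler0_norm ?expR_taylor2_le0//.
have := @le0_is_derive_le
  (fun z => expR z - 1 - z - z ^+ 2 / 2 - z ^+ 3)
  (fun z => expR z - 1 - z - 3 * z ^+ 2) _ _ x0.
rewrite expR0 !expr0n/= !mul0r !subr0 subrr ?subr0 => h.
have {}h : 0 <= expR x - 1 - x - x ^+ 2 / 2 - x ^+ 3.
  apply: h => z.
    move=> _; apply: is_derive_eq; rewrite /GRing.scale/=.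
    by rewrite !(expr2, exprS); lra.
  by move=> /andP[_ z0]; have := expR_taylor2_le0 z0; have := sqr_ge0 z; lra.
have h2 : (- x) ^+ 3 <= (- x) ^+ 3 * expR (- x).
  rewrite ler_peMr ?exprn_ge0 ?oppr_ge0//.
  by rewrite -[leLHS]expR0 ler_expR oppr_ge0.
apply: le_trans h2; rewrite -subr_ge0.
by rewrite (_ : _ - _ = expR x - 1 - x - x ^+ 2 / 2 - x ^+ 3)//; ring.
Qed.

Lemma expR_taylor1 x : `|expR x - 1 - x| <= x ^+ 2 * expR `|x|.
Proof.
have h0 : 0 <= expR x - 1 - x by have := expR_ge1Dx x; lra.
rewrite ger0_norm//.
have [x0|/ltW x0] := leP 0 x; first by rewrite ger0_norm// expR_taylor1_ub.
have := expR_taylor2_le0 x0; have := sqr_ge0 x.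
have : x ^+ 2 <= x ^+ 2 * expR `|x|.
  by rewrite ler_peMr ?sqr_ge0// -[leLHS]expR0 ler_expR.
by lra.
Qed.

Lemma le_sinh u : 0 <= u -> u <= (expR u - expR (- u)) / 2.
Proof.
move=> u0.
have : (expR 0 - expR (- 0)) / 2 - 0 <= (expR u - expR (- u)) / 2 - u.
  apply: (@ge0_is_derive_le (fun z => (expR z - expR (- z)) / 2 - z)
    (fun z => (expR z + expR (- z)) / 2 - 1)) => // z _.
    by apply: is_derive_eq; rewrite /GRing.scale/=; lra.
  by have := expR_ge1Dx z; have := expR_ge1Dx (- z); lra.
by rewrite oppr0 expR0; lra.
Qed.

(* With 1 - y = expR u, the bounds on - ln (1 - y) - y below reduce to le_sinh and
   to the monotonicity of the following function. *)
Let expm1_taylor2 u := u - (expR u - 1) + (expR u - 1) ^+ 2 / 2.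

Let expm1_taylor2_nd u v : u <= v -> expm1_taylor2 u <= expm1_taylor2 v.
Proof.
move=> uv; apply: (@ge0_is_derive_le _ (fun z => (expR z - 1) ^+ 2)) => // z _.
  apply: is_derive_eq; rewrite /GRing.scale/=.
  by rewrite !(expr2, exprS); lra.
exact: sqr_ge0.
Qed.

Let expm1_taylor20 : expm1_taylor2 0 = 0.
Proof. by rewrite /expm1_taylor2 expR0 subrr expr0n/= mul0r; lra. Qed.

(** With [u = ln (1 - y)], the upper bound is exactly sinh (-u) - y. Both comparisons reverse with
    the sign of [u], so the two bounds trade places in [ln1B_le0]. *)
Lemma ln1B_ge0 y : 0 <= y -> y < 1 ->
  y ^+ 2 / 2 <= - ln (1 - y) - y <= y ^+ 2 / (2 * (1 - y)).
Proof.
move=> y0 y1; have w0 : 0 < 1 - y by lra.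
have : ln (1 - y) <= 0 by apply: ln_le0; lra.
have : expR (ln (1 - y)) = 1 - y by rewrite lnK// posrE.
move: (ln (1 - y)) => u eu u0; apply/andP; split.
  have := expm1_taylor2_nd u0; rewrite expm1_taylor20 /expm1_taylor2 eu.
  have -> : (1 - y - 1) ^+ 2 = y ^+ 2 by ring.
  by lra.
have := @le_sinh (- u); rewrite oppr_ge0 opprK => /(_ u0).
rewrite expRN eu => h.
have -> : y ^+ 2 / (2 * (1 - y)) = ((1 - y)^-1 - (1 - y)) / 2 - y.
  by field; rewrite gt_eqF.
by lra.
Qed.

Lemma ln1B_le0 y : y <= 0 ->
  y ^+ 2 / (2 * (1 - y)) <= - ln (1 - y) - y <= y ^+ 2 / 2.
Proof.
move=> y0; have w0 : 0 < 1 - y by lra.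
have : 0 <= ln (1 - y) by apply: ln_ge0; lra.
have : expR (ln (1 - y)) = 1 - y by rewrite lnK// posrE.
move: (ln (1 - y)) => u eu u0; apply/andP; split; last first.
  have := expm1_taylor2_nd u0; rewrite expm1_taylor20 /expm1_taylor2 eu.
  have -> : (1 - y - 1) ^+ 2 = y ^+ 2 by ring.
  by lra.
have := @le_sinh u u0.
rewrite expRN eu => h.
have -> : y ^+ 2 / (2 * (1 - y)) = ((1 - y)^-1 - (1 - y)) / 2 - y.
  by field; rewrite gt_eqF.
by lra.
Qed.

Lemma ln1B_nneg y : y < 1 -> 0 <= - ln (1 - y) - y.
Proof.
move=> y1; have w0 : 0 < 1 - y by lra.
have [y0|/ltW y0] := leP 0 y.
  have /andP[h _] := ln1B_ge0 y0 y1; apply: le_trans h.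
  by rewrite divr_ge0// sqr_ge0.
have /andP[h _] := ln1B_le0 y0; apply: le_trans h.
by rewrite divr_ge0 ?sqr_ge0//; lra.
Qed.

(** A negative [y] already satisfies the bound with [c = 0], which is why only positive parts enter
    the radial pole. *)
Lemma ln1B_ub y c : 0 <= c -> y <= c -> c < 1 ->
  - ln (1 - y) - y <= y ^+ 2 / (2 * (1 - c)).
Proof.
move=> c0 yc c1.
have [y0|/ltW y0] := leP 0 y.
  have /andP[_ /le_trans] := ln1B_ge0 y0 (le_lt_trans yc c1); apply.
  by rewrite ler_wpM2l ?sqr_ge0// lef_pV2 ?posrE; lra.
have /andP[_ /le_trans] := ln1B_le0 y0; apply.
by rewrite ler_wpM2l ?sqr_ge0// lef_pV2 ?posrE; lra.
Qed.

(** The two bounds on [- ln (1 - y) - y] differ by [y ^+ 3 / (2 * (1 - y))], and [y <= 2^-1] makes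
    this denominator at least 1. *)
Lemma ln1B_taylor y : `|y| <= 2^-1 ->
  `|- ln (1 - y) - y - y ^+ 2 / 2| <= `|y| ^+ 3.
Proof.
move=> y2; have /andP[yl yu] : - 2^-1 <= y <= 2^-1 by rewrite -ler_norml.
have w0 : 0 < 1 - y by lra.
have e : y ^+ 2 / (2 * (1 - y)) = y ^+ 2 / 2 + y ^+ 3 / (2 * (1 - y)).
  by field; rewrite gt_eqF.
have i0 : 0 < (2 * (1 - y))^-1 by rewrite invr_gt0; lra.
have i1 : (2 * (1 - y))^-1 <= 1 by rewrite invf_le1; lra.
have [y0|/ltW y0] := leP 0 y.
  have y1 : y < 1 by lra.
  have /andP[h1 h2] := ln1B_ge0 y0 y1.
  rewrite !ger0_norm ?subr_ge0//.
  rewrite e in h2; apply: (@le_trans _ _ (y ^+ 3 / (2 * (1 - y)))); first by lra.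
  by rewrite ler_piMr// exprn_ge0.
have /andP[h1 h2] := ln1B_le0 y0.
rewrite e in h1.
rewrite !ler0_norm ?subr_le0//.
apply: (@le_trans _ _ ((- y) ^+ 3 / (2 * (1 - y)))).
  have -> : (- y) ^+ 3 = - (y ^+ 3) by ring.
  by rewrite mulNr; lra.
by rewrite ler_piMr// exprn_ge0// oppr_ge0.
Qed.

End exp_ln_bounds.

(** * Laws and independence *)

Section weighted_law.
Local Open Scope ereal_scope.
Context {d1 d2 d3 : measure_display} {S1 : measurableType d1}
  {S2 : measurableType d2} {U : measurableType d3} {R : realType}.
Variables (mu : {measure set S1 -> \bar R}) (nu : {measure set S2 -> \bar R}).
Variables (Y1 : S1 -> U) (Y2 : S2 -> U) (g1 : S1 -> R) (g2 : S2 -> R).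
Hypothesis mY1 : measurable_fun setT Y1.
Hypothesis mY2 : measurable_fun setT Y2.
Hypothesis mg1 : measurable_fun setT g1.
Hypothesis mg2 : measurable_fun setT g2.
Hypothesis g1_ge0 : forall x, (0 <= g1 x)%R.
Hypothesis g2_ge0 : forall x, (0 <= g2 x)%R.
Hypothesis same_law : forall B, measurable B ->
  \int[mu]_x (\1_B (Y1 x) * g1 x)%:E = \int[nu]_x (\1_B (Y2 x) * g2 x)%:E.

Import HBNNSimple.

Let integral_nnsfun d (S : measurableType d) (m : {measure set S -> \bar R})
    (Y : S -> U) (g : S -> R) (h : {nnsfun U >-> R}) :
  measurable_fun setT Y -> measurable_fun setT g -> (forall x, 0 <= g x)%R ->
  \int[m]_x (h (Y x) * g x)%:E =
  \sum_(k \in range h) k%:E * \int[m]_x (\1_(h @^-1` [set k]) (Y x) * g x)%:E.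
Proof.
move=> mY mg g0.
have mI k : measurable_fun setT (fun x : S => \1_(h @^-1` [set k]) (Y x) * g x : R)%R.
  by apply: measurable_funM => //; exact: measurableT_comp.
transitivity (\int[m]_x \sum_(k \in range h)
    (k * (\1_(h @^-1` [set k]) (Y x) * g x))%:E).
  apply: eq_integral => x _; rewrite fsumEFin//; congr EFin.
  rewrite [X in (X * _)%R]fimfunE mulrC mulr_fsumr//=.
  by apply: eq_fsbigr => k _; rewrite mulrC mulrA.
rewrite ge0_integral_fsum//.
- apply: eq_fsbigr => k; rewrite inE => -[u _ <-].
  under eq_integral do rewrite EFinM.
  rewrite ge0_integralZl//.
  + by apply/measurable_EFinP.
  + by move=> x _; rewrite lee_fin mulr_ge0.
  + by rewrite lee_fin.
- by move=> k; apply/measurable_EFinP; apply: measurable_funM.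
- move=> k x _; rewrite lee_fin mulrA mulr_ge0//.
  exact: (nnfun_muleindic_ge0 _ _).
Qed.

(** The hypothesis [same_law] is the case of indicators; linearity gives simple functions, monotone
    convergence the rest. The weights let one statement serve laws with a density, Dirac laws, and
    the replacement of one factor in a product of independent ones. *)
Lemma ge0_integral_same_law (f : U -> R) :
  measurable_fun setT f -> (forall y, (0 <= f y)%R) ->
  \int[mu]_x (f (Y1 x) * g1 x)%:E = \int[nu]_x (f (Y2 x) * g2 x)%:E.
Proof.
move=> mf f0.
have mEf : measurable_fun setT (EFin \o f) by apply/measurable_EFinP.
pose h := nnsfun_approx measurableT mEf.
have lim_h d (S : measurableType d) (m : {measure set S -> \bar R})
    (Y : S -> U) (g : S -> R) : measurable_fun setT Y -> measurable_fun setT g ->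
    (forall x, 0 <= g x)%R ->
    \int[m]_x (f (Y x) * g x)%:E =
    limn (fun n => \int[m]_x (h n (Y x) * g x)%:E).
  move=> mY mg g0; rewrite -monotone_convergence//.
  - apply: eq_integral => x _; apply/esym/cvg_lim => //.
    under eq_fun do rewrite EFinM.
    rewrite EFinM; apply: cvgeZr => //.
    by apply: (cvg_nnsfun_approx measurableT mEf) => // y _; rewrite lee_fin.
  - move=> n; apply/measurable_EFinP; apply: measurable_funM => //.
    exact: measurableT_comp.
  - by move=> n x _; rewrite lee_fin mulr_ge0.
  - move=> x _ a b ab; rewrite lee_fin ler_wpM2r//.
    exact/lefP/nd_nnsfun_approx.
rewrite (lim_h _ _ mu Y1 g1)// (lim_h _ _ nu Y2 g2)//.
congr (limn _); apply/funext => n.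
rewrite !integral_nnsfun//; apply: eq_fsbigr => k _.
by rewrite same_law.
Qed.

End weighted_law.

(** * Expectation of a product of independent factors *)

Section independence.
Local Open Scope ereal_scope.
Context {disp : measure_display} {T : measurableType disp} {R : realType}.
Variables (P : probability T R) (I : finType) (F : I -> set (set T)).
Variable f : I -> T -> R.
Hypothesis indepF : independent_systems P F.
Hypothesis f_meas : forall i, measurable_fun setT (f i).
Hypothesis f_ge0 : forall i w, (0 <= f i w)%R.
Hypothesis sigma_f : forall i B, measurable B -> F i (f i @^-1` B).
Hypothesis f_fin : forall i, 'E_P[f i] < +oo.

Let E_fin i : 'E_P[f i] \is a fin_num.
Proof. by rewrite ge0_fin_numE// expectation_ge0. Qed.

Let mpre i B : measurable B -> measurable (f i @^-1` B).
Proof. by move=> mB; rewrite -[X in measurable X]setTI; exact: f_meas. Qed.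

(* The factors are replaced one at a time, starting from indicators. *)
Let mixed (J : {set I}) (B : I -> set R) : (forall i, measurable (B i)) ->
  'E_P[fun w => \prod_i (if i \in J then f i w else \1_(B i) (f i w))]%R =
  \prod_i (if i \in J then 'E_P[f i] else P (f i @^-1` B i)).
Proof.
have [n] := ubnP #|J|; elim: n J B => // n IH J B /ltnSE Jn mB.
have [->|/finset.set0Pn[j jJ]] := eqVneq J finset.set0.
  (* With indicators only, the product is the indicator of an intersection and the claim is the
     independence of events. *)
  transitivity ('E_P[\1_(\bigcap_(i in [set` [set: I]%SET]) (f i @^-1` B i))]).
    congr expectation; apply/funext => w.
    under eq_bigr do rewrite inE.
    rewrite indicE; case: (boolP (w \in _)) => [|/negP] wB.
      rewrite big1// => i _; rewrite indicE mem_set//.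
      by move: wB; rewrite inE => /(_ i); apply; rewrite /= inE.
    have [/forallP h|] := boolP [forall i, `[<B i (f i w)>]].
      by exfalso; apply: wB; apply/mem_set => i _; exact/asboolP/h.
    rewrite negb_forall => /existsP[i /asboolP nB].
    by rewrite (bigD1 i)//= indicE memNset ?mul0r.
  rewrite expectation_indic; last first.
    by apply: fin_bigcap_measurable => // i _; exact: mpre.
  rewrite indepF; last by move=> i; exact: sigma_f.
  by apply: eq_big => i; rewrite ?finset.in_setT ?finset.in_set0.
pose g w : R := (\prod_(i | i != j)
  (if i \in J then f i w else \1_(B i) (f i w)))%R.
pose C := \prod_(i | i != j) (if i \in J then 'E_P[f i] else P (f i @^-1` B i)).
have mg : measurable_fun setT g.
  rewrite (_ : g = fun w => (\prod_(i <- [seq i <- index_enum I | i != j])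
    (if i \in J then f i w else \1_(B i) (f i w)))%R); last first.
    by apply/funext => w; rewrite big_filter.
  apply: measurable_prod => i _; case: (i \in J) => //.
  by apply: measurableT_comp => //; exact: measurable_indic.
have g0 w : (0 <= g w)%R.
  by apply: prodr_ge0 => i _; case: ifP => _.
have Cfin : C \is a fin_num.
  rewrite /C; apply: (big_ind (fun x => x \is a fin_num)) => //.
    by move=> x y; exact: fin_numM.
  by move=> i _; case: ifP => _; [exact: E_fin|apply: fin_num_measure; exact: mpre].
have C0 : 0 <= C.
  apply: prode_ge0 => i _; case: ifP => _ //.
  exact: expectation_ge0.
have CE : C = (fine C)%:E by rewrite fineK.
(* The law of [f j] weighted by the other factors is a constant multiple of its law: this is the
   induction hypothesis with the indicator of [D] in place of the factor [j]. *)
have law D : measurable D ->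
    \int[P]_x (\1_D (f j x) * g x)%:E = \int[P]_x (\1_D (f j x) * fine C)%:E.
  move=> mD.
  pose B' i := if i == j then D else B i.
  have mB' i : measurable (B' i) by rewrite /B'; case: ifP.
  transitivity ('E_P[fun w => \prod_i (if i \in (J :\ j)%SET then f i w
      else \1_(B' i) (f i w))]%R).
    rewrite unlock; apply: eq_integral => x _; congr EFin.
    rewrite (bigD1 j)//= !inE eqxx /B' eqxx/=; congr (_ * _)%R.
    by apply: eq_bigr => i ij; rewrite !inE ij (negbTE ij).
  rewrite IH//; last by rewrite (leq_trans _ Jn)// [in leqRHS](cardsD1 j) jJ.
  rewrite (bigD1 j)//= !inE eqxx/= {1}/B' eqxx.
  rewrite (eq_bigr (fun i => if i \in J then 'E_P[f i] else P (f i @^-1` B i)));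
    last by move=> i ij; rewrite !inE ij /B' (negbTE ij).
  rewrite -/C; under [RHS]eq_integral do rewrite EFinM.
  rewrite ge0_integralZr//.
  - rewrite -CE; congr (_ * _).
    rewrite -(@expectation_indic _ _ _ P (f j @^-1` D)) ?unlock//.
    exact: mpre.
  - by apply/measurable_EFinP; apply: measurableT_comp => //; exact: measurable_indic.
  - by rewrite -CE.
rewrite [RHS](bigD1 j)//= jJ -/C unlock.
under eq_integral => x _.
  rewrite (bigD1 j)//= jJ -/(g x) -[f j x]ger0_norm//.
  over.
(* The test function must be nonnegative on all of R, so the absolute value stands in for the
   identity; they agree on the values of [f j]. *)
rewrite (@ge0_integral_same_law _ _ _ _ _ _ _ P P (f j) (f j) g (cst (fine C))
  _ _ _ _ _ _ law Num.norm)//=; last by move=> x; exact: fine_ge0.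
under eq_integral do rewrite ger0_norm// EFinM.
rewrite ge0_integralZr//.
- by rewrite -CE.
- exact/measurable_EFinP.
- by move=> x _; rewrite lee_fin.
- by rewrite -CE.
Qed.

Lemma expectation_prod_independent :
  'E_P[fun w => \prod_i f i w]%R = \prod_i 'E_P[f i].
Proof.
have := @mixed [set: I]%SET (fun=> setT) (fun=> measurableT).
under eq_fun do under eq_bigr do rewrite inE.
by under [RHS]eq_bigr do rewrite inE.
Qed.

End independence.

Section laws.
Local Open Scope ereal_scope.
Context {disp : measure_display} {T : measurableType disp} {R : realType}.
Variables (P : probability T R) (Y : T -> R).
Hypothesis mY : measurable_fun setT Y.
Local Notation mu := (@lebesgue_measure R).

Let integral_preimage B : measurable B ->
  \int[P]_x (\1_B (Y x) * cst 1%R x)%:E = P (Y @^-1` B).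
Proof.
move=> mB; have mYB : measurable (Y @^-1` B).
  by rewrite -[X in measurable X]setTI; exact: mY.
rewrite -[RHS](@expectation_indic _ _ _ P)// unlock.
by apply: eq_integral => x _; rewrite mulr1.
Qed.

Lemma expectation_density (p f : R -> R) :
  measurable_fun setT p -> (forall x, (0 <= p x)%R) ->
  (forall B, measurable B -> P (Y @^-1` B) = \int[mu]_(x in B) (p x)%:E) ->
  measurable_fun setT f -> (forall x, (0 <= f x)%R) ->
  'E_P[f \o Y] = \int[mu]_x (f x * p x)%:E.
Proof.
move=> mp p0 law mf f0; rewrite unlock.
under eq_integral => w _ do rewrite /= -[f (Y w)]mulr1.
apply: (@ge0_integral_same_law _ _ _ _ _ _ _ P mu Y id (cst 1%R) p) => // B mB.
rewrite integral_preimage// law//.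
rewrite [LHS]integral_mkcond; apply: eq_integral => x _.
by rewrite /patch indicE; case: (x \in B); rewrite ?mul1r ?mul0r.
Qed.

Lemma expectation_dirac_law (m : R) (f : R -> R) :
  (forall B, measurable B -> P (Y @^-1` B) = \d_m B) ->
  measurable_fun setT f -> (forall x, (0 <= f x)%R) ->
  'E_P[f \o Y] = (f m)%:E.
Proof.
move=> law mf f0; rewrite unlock.
under eq_integral => w _ do rewrite /= -[f (Y w)]mulr1.
rewrite (@ge0_integral_same_law _ _ _ _ _ _ _ P (\d_m) Y id (cst 1%R) (cst 1%R))//.
  rewrite integral_dirac//; last first.
    by apply/measurable_EFinP; exact: measurable_funM.
  by rewrite diracT mul1e mulr1.
move=> B mB.
rewrite integral_preimage// law//.
under eq_integral do rewrite mulr1.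
by rewrite integral_indic// setIT.
Qed.

End laws.

(** * Change of scale in Lebesgue integrals *)

Section lebesgue_scaling.
Local Open Scope ereal_scope.
Context {R : realType}.
Local Notation mu := (@lebesgue_measure R).

Let pushforward_measure (g : measurableTypeR R -> measurableTypeR R)
  (mg : measurable_fun setT g) : {measure set (measurableTypeR R) -> \bar R} :=
  measure_function_pushforward__canonical__measure_function_Measure mu mg.

(** By uniqueness of Lebesgue measure it is enough to test half-open intervals: the preimage of []a,
    b]] has length [(b - a) / k]. *)
Lemma lebesgue_measure_scale (k : R) (A : set R) : (0 < k)%R -> measurable A ->
  k%:E * pushforward mu ( *%R k : _ -> measurableTypeR R) A = mu A.
Proof.
move=> k0 mA; pose K : {nonneg R} := NngNum (ltW k0).
have mk : measurable_fun setT ( *%R k : measurableTypeR R -> measurableTypeR R).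
  exact: mulrl_measurable.
rewrite [RHS](@lebesgue_measure_unique R (mscale K (pushforward_measure mk)))//.
move=> _ [[a b]] _ <-.
rewrite /= /mscale/= /pushforward.
rewrite (_ : _ @^-1` _ = `](a / k)%R, (b / k)%R]%classic); last first.
  apply/seteqP; split => x /=; rewrite !in_itv/= ltr_pdivrMr// ler_pdivlMr//;
  by rewrite mulrC.
rewrite !lebesgue_measure_itv/= !lte_fin ltr_pM2r ?invr_gt0//.
case: ifPn => _; last by rewrite mule0.
by rewrite -!EFinB -EFinM; congr EFin; field; rewrite gt_eqF.
Qed.

Lemma ge0_integral_scale (k : R) (f : R -> R) : (0 < k)%R ->
  measurable_fun setT f -> (forall x, (0 <= f x)%R) ->
  \int[mu]_x (f x)%:E = k%:E * \int[mu]_x (f (k * x))%:E.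
Proof.
move=> k0 mf f0; pose K : {nonneg R} := NngNum (ltW k0).
have mEf : measurable_fun setT (EFin \o f) by apply/measurable_EFinP.
have mk : measurable_fun setT ( *%R k : measurableTypeR R -> measurableTypeR R).
  exact: mulrl_measurable.
have <- : \int[pushforward_measure mk]_x (f x)%:E = \int[mu]_x (f (k * x))%:E.
  rewrite ge0_integral_pushforward//.
  by move=> x _; rewrite lee_fin.
rewrite -[k%:E]/(K%:num%:E) -ge0_integral_mscale//; last first.
  by move=> x _; rewrite lee_fin.
apply: eq_measure_integral => A mA _.
exact/esym/lebesgue_measure_scale.
Qed.

End lebesgue_scaling.

(** * Moment generating functions of gamma and normal laws *)

Section gamma_mgf.
Local Open Scope ereal_scope.
Context {disp : measure_display} {T : measurableType disp} {R : realType}.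
Variables (P : probability T R).
Local Notation mu := (@lebesgue_measure R).

Lemma gamma_pdf_ge0 (a b x : R) : (0 <= gamma_pdf a b x)%R.
Proof.
rewrite /gamma_pdf; case: ifPn => // x0.
rewrite divr_ge0// mulr_ge0 ?powR_ge0 ?expR_ge0//.
by apply: Rintegral_ge0 => y _; rewrite mulr_ge0 ?powR_ge0 ?expR_ge0.
Qed.

Lemma measurable_gamma_pdf (a b : R) : measurable_fun setT (gamma_pdf a b).
Proof.
apply: measurable_fun_ifT => //=.
  by apply: measurable_fun_ltr.
apply: measurable_funM => //; apply: measurable_funM => //.
apply: measurableT_comp => //; apply: measurableT_comp => //.
exact: measurable_funM.
Qed.

Lemma gamma_mgf (a b c : R) (Y : T -> R) : measurable_fun setT Y ->
  (0 < b)%R -> is_gamma P a b Y -> (b * c < 1)%R ->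
  'E_P[(fun w => expR (c * Y w))%R] = (expR (- (a * ln (1 - b * c))))%:E.
Proof.
move=> mY b0 law bc.
have k0 : (0 < 1 - b * c)%R by rewrite subr_gt0.
set k := (1 - b * c)%R in k0 *.
rewrite -[LHS]/('E_P[(fun x => expR (c * x)) \o Y]%R).
rewrite (@expectation_density _ _ _ P Y mY (gamma_pdf a b))//; first last.
- apply: measurableT_comp => //; exact: measurable_funM.
- exact: gamma_pdf_ge0.
- exact: measurable_gamma_pdf.
(* The normalisation is read off from the law: the whole line has probability 1. *)
have total : \int[mu]_x (gamma_pdf a b x)%:E = 1.
  by rewrite -law// preimage_setT probability_setT.
rewrite (ge0_integral_scale k0 (measurable_gamma_pdf a b) (gamma_pdf_ge0 a b)) in total.
(* Scaling by k = 1 - b c tilts the density exponentially, so the value of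
   Gamma a is never needed. *)
have kE x : gamma_pdf a b (k * x) =
    (k `^ (a - 1) * (expR (c * x) * gamma_pdf a b x))%R.
  rewrite /gamma_pdf pmulr_rgt0//; case: ifPn => x0; last by rewrite !mulr0.
  rewrite powRM ?ltW//.
  have -> : (- (k * x / b) = c * x + - (x / b))%R.
    by rewrite /k; field; rewrite gt_eqF.
  by rewrite expRD; ring.
move: total; under eq_integral do rewrite kE EFinM.
rewrite ge0_integralZl//; last 3 first.
- apply/measurable_EFinP/measurable_funM; last exact: measurable_gamma_pdf.
  apply: measurableT_comp => //; exact: measurable_funM.
- by move=> x _; rewrite lee_fin mulr_ge0 ?expR_ge0// gamma_pdf_ge0.
- by rewrite lee_fin powR_ge0.
(* The Jacobian [k] raises the exponent from a - 1 to a, so the expectation times k^a equals 1. *)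
rewrite muleA -EFinM -{1}[k]powRr1 ?ltW// -powRD; last by rewrite (gt_eqF k0) implybT.
rewrite addrC subrK => total.
have ka : expR (a * ln k) = (k `^ a)%R by rewrite /powR gt_eqF.
have ka1 : 1 = ((k `^ a)^-1 * k `^ a)%:E by rewrite mulVf// gt_eqF// powR_gt0.
by rewrite expRN ka -[LHS]mul1e ka1 EFinM -muleA total mule1.
Qed.

Lemma normal_mgf (m s c : R) (Y : T -> R) : measurable_fun setT Y ->
  (forall B, measurable B -> P (Y @^-1` B) = normal_law m s B) ->
  'E_P[(fun w => expR (c * Y w))%R] =
    (expR (c * m + c ^+ 2 * s ^+ 2 / 2))%:E.
Proof.
move=> mY law.
have mexp : measurable_fun setT (fun x : R => expR (c * x)).
  apply: measurableT_comp => //; exact: measurable_funM.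
rewrite -[LHS]/('E_P[(fun x => expR (c * x)) \o Y]%R).
have [s0|s0] := eqVneq s 0%R.
  rewrite (@expectation_dirac_law _ _ _ P Y mY m)//.
    by rewrite s0 expr0n/= mulr0 mul0r addr0.
  by move=> B mB; rewrite law// /normal_law s0 eqxx.
rewrite (@expectation_density _ _ _ P Y mY (normal_pdf m s))//; first last.
- by move=> B mB; rewrite law// /normal_law (negbTE s0).
- exact: normal_pdf_ge0.
- exact: measurable_normal_pdf.
(* Completing the square: the exponential tilt moves the mean by [c * s ^+ 2], and the shifted
   density again has mass 1. *)
have shift x : (expR (c * x) * normal_pdf m s x = 
  expR (c * m + c ^+ 2 * s ^+ 2 / 2) * normal_pdf (m + c * s ^+ 2) s x)%R.
  rewrite !normal_pdfE// mulrCA [in RHS]mulrCA; congr (_ * _)%R.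
  rewrite /normal_fun -!expRD; congr expR.
  by field.
under eq_integral do rewrite shift EFinM.
rewrite ge0_integralZl//.
- by rewrite integral_normal_pdf mule1.
- by apply/measurable_EFinP; exact: measurable_normal_pdf.
- by move=> x _; rewrite lee_fin normal_pdf_ge0.
Qed.

End gamma_mgf.

(** * Coefficients forced to vanish by a cubic bound *)

Section real_lemmas.
Context {R : realType}.
Implicit Types a b d M : R.

Lemma linear_bound_eq0 a d M : 0 < d ->
  (forall r, 0 < r <= d -> `|a| <= r * M) -> a = 0.
Proof.
move=> d0 h; apply/eqP; apply: contraT => a0.
have na0 : 0 < `|a| by rewrite normr_gt0.
have M0 : 0 <= M.
  have := h d; rewrite d0 lexx => /(_ isT) h1.
  by rewrite -(pmulr_rge0 M d0); lra.
have M1 : 0 < M + 1 by lra.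
(* This choice makes [r * M] smaller than |a|; the added 1 keeps the denominator positive when
   [M = 0]. *)
pose r := Num.min d (`|a| / (2 * (M + 1))).
have r0 : 0 < r by rewrite lt_min d0 divr_gt0// mulr_gt0.
have rd : r <= d by rewrite ge_min lexx.
have := h r; rewrite r0 rd => /(_ isT) h1.
have h2 : r * M <= `|a| / (2 * (M + 1)) * M.
  by rewrite ler_wpM2r// ge_min lexx orbT.
have h3 : `|a| / (2 * (M + 1)) * M < `|a|.
  rewrite -mulrA gtr_pMr// mulrC ltr_pdivrMr ?mul1r; lra.
by have := lt_le_trans (le_lt_trans h2 h3) h1; rewrite ltxx.
Qed.

(** Comparing [r] with [- r] separates odd from even: |a| and [r] |b| are both at most [r ^+ 2 * M].
    Each is then a linear bound for arbitrarily small [r]. *)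
Lemma cubic_bound_eq0 a b d M : 0 < d ->
  (forall r, `|r| <= d -> `|r * a + r ^+ 2 * b| <= `|r| ^+ 3 * M) ->
  a = 0 /\ b = 0.
Proof.
move=> d0 h.
have key r : 0 < r <= d -> `|a + r * b| <= r ^+ 2 * M /\
    `|- a + r * b| <= r ^+ 2 * M.
  move=> /andP[r0 rd]; split.
    have := h r; rewrite (gtr0_norm r0) => /(_ rd).
    rewrite (_ : r * a + r ^+ 2 * b = r * (a + r * b)); last by ring.
    rewrite normrM (gtr0_norm r0) exprS -mulrA ler_pM2l//.
  have := h (- r); rewrite normrN (gtr0_norm r0) => /(_ rd).
  rewrite (_ : - r * a + (- r) ^+ 2 * b = r * (- a + r * b)); last by ring.
  by rewrite normrM (gtr0_norm r0) exprS -mulrA ler_pM2l.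
split.
- apply: (@linear_bound_eq0 a d (d * M) d0) => r rd.
  have [h1 h2] := key r rd; move: rd => /andP[r0 rd].
  move: h1 h2; rewrite !ler_norml => /andP[h1 h2] /andP[h3 h4].
  have h5 : r ^+ 2 * M <= r * (d * M).
    rewrite mulrA; apply: ler_wpM2r; last by rewrite expr2 ler_pM2l.
    by rewrite -(pmulr_rge0 M (exprn_gt0 2 r0)); lra.
  by apply/andP; split; lra.
- apply: (@linear_bound_eq0 b d M d0) => r rd.
  have [h1 h2] := key r rd; move: rd => /andP[r0 rd].
  rewrite -(ler_pM2l r0) -{1}(gtr0_norm r0) -normrM mulrA -expr2.
  by move: h1 h2; rewrite !ler_norml => /andP[h1 h2] /andP[h3 h4];
    apply/andP; split; lra.
Qed.

End real_lemmas.

(** * Mean and variance from a moment generating function *)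

Section moments_from_mgf.
Context {disp : measure_display} {T : measurableType disp} {R : realType}.
Variables (P : probability T R) (Y : T -> R) (k : R -> R) (V C delta : R).
Hypothesis mY : measurable_fun setT Y.
Hypothesis delta_gt0 : 0 < delta.
Hypothesis mgf : forall r : R, `|r| <= delta ->
  ('E_P[fun w => expR (r * Y w)] = (expR (k r))%:E)%E.
Hypothesis cumulant_taylor : forall r : R, `|r| <= delta ->
  `|k r - r ^+ 2 * V / 2| <= `|r| ^+ 3 * C.

(** A majorant of exp (delta |Y|), integrable by [mgf] at the two endpoints. It dominates [Y], its
    square and the cubic Taylor remainder, up to constants. *)
Let W w := expR (delta * Y w) + expR (- delta * Y w).

Let mexp r : measurable_fun setT (fun w => expR (r * Y w)).
Proof. by apply: measurableT_comp => //; exact: measurable_funM. Qed.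

Let int_exp (r : R) : `|r| <= delta ->
  P.-integrable setT (EFin \o (fun w => expR (r * Y w))).
Proof.
move=> rd; apply/integrableP; split; first exact/measurable_EFinP.
under eq_integral => w _ do rewrite /= gtr0_norm ?expR_gt0//.
by have := mgf rd; rewrite unlock => ->; rewrite ltry.
Qed.

Let int_W : P.-integrable setT (EFin \o W).
Proof.
apply: (integrableD measurableT (int_exp (r := delta) _)
  (int_exp (r := - delta) _)); first by rewrite gtr0_norm.
by rewrite normrN gtr0_norm.
Qed.

Let expR_absY_le w : expR (delta * `|Y w|) <= W w.
Proof.
rewrite /W; have [y0|/ltW y0] := leP 0 (Y w).
  by rewrite ger0_norm// lerDl expR_ge0.
by rewrite ler0_norm// mulrN -mulNr lerDr expR_ge0.
Qed.

Let dom (f : T -> R) c : measurable_fun setT f ->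
  (forall w, `|f w| <= c * W w) -> P.-integrable setT (EFin \o f).
Proof.
move=> mf fc.
have iW : P.-integrable setT (EFin \o (fun w => c * W w)).
  exact: (integrableZl measurableT c int_W).
apply: le_integrable iW => //; first exact/measurable_EFinP.
by move=> w _ /=; rewrite lee_fin (le_trans (fc w))// ler_norm.
Qed.

Let pow_le n w :
  `|Y w| ^+ n.+1 <= n.+1`!%:R / delta ^+ n.+1 * expR (delta * `|Y w|).
Proof.
have h := @expR_ge1Dxn _ (delta * `|Y w|) n.
have {}h := h (mulr_ge0 (ltW delta_gt0) (normr_ge0 _)).
rewrite mulrAC ler_pdivlMr ?exprn_gt0// -exprMn.
rewrite -ler_pdivrMl ?ltr0n ?fact_gt0// [_^-1 * _]mulrC.
rewrite [`|Y w| * _]mulrC.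
by apply: le_trans h; rewrite lerDr.
Qed.

Let int_Y : P.-integrable setT (EFin \o Y).
Proof.
apply: (@dom _ (1%N`!%:R / delta ^+ 1)) => // w.
rewrite -[`|_|]expr1 (le_trans (pow_le 0 w))// ler_wpM2l//.
by rewrite divr_ge0// exprn_ge0// ltW.
Qed.

Let int_Y2 : P.-integrable setT (EFin \o (fun w => Y w ^+ 2)).
Proof.
apply: (@dom _ (2%N`!%:R / delta ^+ 2)); first exact: measurable_funX.
move=> w; rewrite normrX (le_trans (pow_le 1 w))// ler_wpM2l//.
by rewrite divr_ge0// exprn_ge0// ltW.
Qed.


(** The exponent [delta] is split in two: one half bounds the exponential factor of [expR_taylor2],
    the other absorbs |Y|^3 at the cost of 3! / (delta / 2)^3. *)
Let remainder_le (r : R) w : `|r| <= delta / 2 ->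
  `|expR (r * Y w) - 1 - r * Y w - r ^+ 2 / 2 * Y w ^+ 2| <=
  `|r| ^+ 3 * (6 / (delta / 2) ^+ 3 * W w).
Proof.
move=> rd.
have d20 : 0 < delta / 2 by rewrite divr_gt0.
have -> : r ^+ 2 / 2 * Y w ^+ 2 = (r * Y w) ^+ 2 / 2 by rewrite exprMn; lra.
apply: le_trans (expR_taylor2 _) _.
rewrite normrM exprMn -[leLHS]mulrA; apply: ler_wpM2l; first exact: exprn_ge0.
rewrite [leRHS]mulrAC ler_pdivlMr ?exprn_gt0//.
have h1 : (`|Y w| * (delta / 2)) ^+ 3 <= 6 * expR (`|Y w| * (delta / 2)).
  have y0 : 0 <= `|Y w| * (delta / 2) by rewrite mulr_ge0// ltW.
  have := @expR_ge1Dxn _ _ 2 y0.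
  by rewrite (_ : 3`!%:R = 6)//; lra.
have h2 : expR (`|r| * `|Y w|) <= expR (`|Y w| * (delta / 2)).
  by rewrite ler_expR mulrC ler_wpM2l.
have h3 : expR (`|Y w| * (delta / 2)) * expR (`|Y w| * (delta / 2)) =
    expR (delta * `|Y w|).
  by rewrite -expRD; congr expR; lra.
rewrite mulrAC -exprMn.
apply: (@le_trans _ _ (6 * expR (`|Y w| * (delta / 2)) *
    expR (`|Y w| * (delta / 2)))).
  by apply: ler_pM => //; rewrite ?expR_ge0// exprn_ge0// mulr_ge0// ltW.
by rewrite -mulrA h3 ler_pM2l// expR_absY_le.
Qed.

Let K := 6 / (delta / 2) ^+ 3 * (\int[P]_w W w)%R.

Let mgf_taylor (r : R) : `|r| <= delta / 2 ->
  `|expR (k r) - 1 - r * (\int[P]_w Y w)%R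
     - r ^+ 2 / 2 * (\int[P]_w (Y w ^+ 2))%R| <= `|r| ^+ 3 * K.
Proof.
move=> rd; have rd' : `|r| <= delta by apply: le_trans rd _; move: delta_gt0; lra.
have ie := int_exp rd'.
have i1 : P.-integrable setT (EFin \o (fun=> 1 : R)).
  exact: finite_measure_integrable_cst.
have irY : P.-integrable setT (EFin \o (fun w => r * Y w)).
  exact: (integrableZl measurableT r int_Y).
have irY2 : P.-integrable setT (EFin \o (fun w => r ^+ 2 / 2 * Y w ^+ 2)).
  exact: (integrableZl measurableT (r ^+ 2 / 2) int_Y2).
have ie1 : P.-integrable setT (EFin \o (fun w => expR (r * Y w) - 1)).
  exact: (integrableB measurableT ie i1).
have ie2 : P.-integrable setT (EFin \o (fun w => expR (r * Y w) - 1 - r * Y w)).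
  exact: (integrableB measurableT ie1 irY).
have ie3 : P.-integrable setT
    (EFin \o (fun w => expR (r * Y w) - 1 - r * Y w - r ^+ 2 / 2 * Y w ^+ 2)).
  exact: (integrableB measurableT ie2 irY2).
have -> : expR (k r) = (\int[P]_w expR (r * Y w))%R.
  by have := mgf rd'; rewrite unlock /Rintegral => ->.
have E1 : (\int[P]_w (1 : R))%R = 1.
  rewrite /Rintegral integral_cst//= probability_setT mule1. by [].
rewrite -[X in _ - X - _ - _]E1 -RintegralZl// -RintegralZl//.
rewrite -!RintegralB//.
apply: le_trans (le_normr_Rintegral _ ie3) _ => //.
have iKW : P.-integrable setT (EFin \o (fun w => 6 / (delta / 2) ^+ 3 * W w)).
  exact: (integrableZl measurableT (6 / (delta / 2) ^+ 3) int_W).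
rewrite /K -RintegralZl// -RintegralZl//.
apply: le_Rintegral => //.
- exact: integrable_norm.
- exact: (integrableZl measurableT (`|r| ^+ 3) iKW).
- by move=> w _; exact: remainder_le.
Qed.

(** Since k r = r^2 V / 2 + O(r^3), also exp (k r) = 1 + r^2 V / 2 + O(r^3). Subtracting this from
    [mgf_taylor] leaves a polynomial without constant term that [cubic_bound_eq0] annihilates. *)
Let moments_eq : (\int[P]_w Y w)%R = 0 /\ (\int[P]_w (Y w ^+ 2))%R = V.
Proof.
(* For |r| <= 1 this bounds both |k r| / r^2 and |k r|, so the error (k r)^2 exp |k r| of
   [expR_taylor1] is O(r^4), hence O(r^3). *)
pose L := `|V| / 2 + `|C|.
have L0 : 0 <= L by rewrite addr_ge0// divr_ge0.
pose d := Num.min (delta / 2) 1.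
have d0 : 0 < d by rewrite lt_min ltr01 andbT; rewrite divr_gt0.
have [] := @cubic_bound_eq0 R (\int[P]_w Y w)%R
    (((\int[P]_w (Y w ^+ 2))%R - V) / 2) d (K + L ^+ 2 * expR L + `|C|) d0.
  move=> r; rewrite le_min => /andP[rd r1].
  have rd' : `|r| <= delta by apply: le_trans rd _; move: delta_gt0; lra.
  have h1 := mgf_taylor rd.
  have h2 := cumulant_taylor rd'.
  have h3 := expR_taylor1 (k r).
  have r23 : `|r| ^+ 3 <= `|r| ^+ 2 by rewrite exprS ler_piMl// exprn_ge0.
  have h2' : `|k r - r ^+ 2 * V / 2| <= `|r| ^+ 3 * `|C|.
    by apply: le_trans h2 _; rewrite ler_wpM2l ?exprn_ge0// ler_norm.
  have kL : `|k r| <= `|r| ^+ 2 * L.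
    rewrite -[k r](subrK (r ^+ 2 * V / 2)) (le_trans (ler_normD _ _))//.
    have -> : `|r ^+ 2 * V / 2| = `|r| ^+ 2 * (`|V| / 2).
      by rewrite -mulrA normrM normrX normrM [`|2^-1|]ger0_norm.
    rewrite [leRHS]mulrDr addrC lerD2l.
    by apply: le_trans h2' _; rewrite ler_wpM2r.
  have kL1 : `|k r| <= L.
    by apply: le_trans kL _; rewrite ler_piMl// expr_le1.
  have h4 : k r ^+ 2 * expR `|k r| <= `|r| ^+ 3 * (L ^+ 2 * expR L).
    rewrite mulrA; apply: ler_pM; rewrite ?sqr_ge0 ?expR_ge0 ?ler_expR//.
    rewrite -[k r ^+ 2]ger0_norm ?sqr_ge0// normrX.
    apply: (@le_trans _ _ ((`|r| ^+ 2 * L) ^+ 2)).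
      by rewrite ler_pXn2r// nnegrE mulr_ge0// exprn_ge0.
    rewrite exprMn ler_wpM2r ?sqr_ge0// -exprM.
    by rewrite [leLHS]exprS ler_piMl// exprn_ge0.
  rewrite !mulrDr.
  move: h1 h2' h3 h4; move: (`|r| ^+ 3 * K) (`|r| ^+ 3 * (L ^+ 2 * expR L))
    (`|r| ^+ 3 * `|C|) (k r ^+ 2 * expR `|k r|) => a1 a2 a3 a4.
  rewrite !ler_norml => /andP[b1 b2] /andP[b3 b4] /andP[b5 b6] b7.
  by apply/andP; split; lra.
by move=> ->; lra.
Qed.

Lemma moments_of_mgf :
  [/\ Y \in Lfun P 2%:E, ('E_P[Y] = 0)%E & ('V_P[Y] = V%:E)%E].
Proof.
have [e1 e2] := moments_eq.
have l2 : Y \in Lfun P 2%:E.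
  rewrite inE; apply/andP; split; rewrite inE//=.
  rewrite /finite_norm unlock /=.
  apply: poweR_lty.
  under eq_integral => w _.
    rewrite powR_mulrn// -normrX ger0_norm ?sqr_ge0//.
    over.
  exact: (integrable_lty measurableT int_Y2).
have E1 : ('E_P[Y] = 0)%E.
  by rewrite unlock -[LHS]fineK ?integrable_fin_num// -/(Rintegral _ _ _) e1.
split => //.
rewrite varianceE// E1 expe2 mule0 sube0 unlock.
by rewrite -[LHS]fineK ?integrable_fin_num// -/(Rintegral _ _ _) e2.
Qed.

End moments_from_mgf.

(** * Covariance and convex geometry *)

Section dotp_theory.
Context {R : realType} {d : nat}.
Implicit Types (t u v : 'rV[R]_d) (a : R).

Lemma dotpE u v : dotp u v = \sum_i u 0 i * v 0 i.
Proof. by rewrite /dotp mxE; apply: eq_bigr => i _; rewrite mxE. Qed.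

Lemma dotpC u v : dotp u v = dotp v u.
Proof. by rewrite !dotpE; apply: eq_bigr => i _; rewrite mulrC. Qed.

Lemma dotpDr t u v : dotp t (u + v) = dotp t u + dotp t v.
Proof. by rewrite /dotp linearD mulmxDr mxE. Qed.

Lemma dotpZr t a u : dotp t (a *: u) = a * dotp t u.
Proof. by rewrite /dotp linearZ -scalemxAr mxE. Qed.

Lemma dotpZl t a u : dotp (a *: t) u = a * dotp t u.
Proof. by rewrite dotpC dotpZr dotpC. Qed.

Lemma dotp0r t : dotp t 0 = 0.
Proof. by rewrite /dotp linear0 mulmx0 mxE. Qed.

Lemma dotp_sumr (I : finType) t (f : I -> 'rV[R]_d) :
  dotp t (\sum_i f i) = \sum_i dotp t (f i).
Proof.
by elim/big_rec2: _ => [|i x y _ <-]; rewrite ?dotp0r// dotpDr.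
Qed.

Lemma dotp_delta (i : 'I_d) u : dotp (delta_mx 0 i) u = u 0 i.
Proof.
rewrite dotpE (bigD1 i)//= mxE !eqxx mul1r big1 ?addr0// => j ji.
by rewrite mxE (negbTE ji) andbF mul0r.
Qed.

Lemma qformZ (S : 'M[R]_d) a t : qform S (a *: t) = a ^+ 2 * qform S t.
Proof.
by rewrite /qform linearZ/= -!scalemxAl -scalemxAr scalerA mxE -expr2.
Qed.

Lemma continuous_dotp t : continuous (dotp t).
Proof.
move=> u; rewrite (_ : dotp t = fun v => \sum_i t 0 i * v 0 i); last first.
  by apply/funext => v; rewrite dotpE.
elim: (index_enum _) => [|i s IH].
  rewrite (_ : (fun _ => _) = cst 0); first exact: cst_continuous.
  by apply/funext => v; rewrite big_nil.
rewrite (_ : (fun _ => _) = (fun v : 'rV[R]_d => t 0 i * v 0 i) +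
    (fun v : 'rV[R]_d => \sum_(j <- s) t 0 j * v 0 j)); last first.
  by apply/funext => v; rewrite big_cons.
apply: (@continuousD _ R^o) => //.
by apply: continuousM; [exact: cst_continuous|exact: coord_continuous].
Qed.

Lemma measurable_dotp t :
  measurable_fun setT (dotp t : borel_rV R d -> R).
Proof.
apply: (measurability _ (RGenOInfty.measurableE R)) => //.
move=> _ [_ [x ->] <-]; rewrite setTI.
apply: sub_sigma_algebra; apply: open_comp; last exact: interval_open.
by move=> u _; exact: continuous_dotp.
Qed.

End dotp_theory.

(** * Covariance matrix and linear functionals *)

Section covariance_matrix.
Local Open Scope ereal_scope.
Context {disp : measure_display} {T : measurableType disp} {R : realType}.
Context {d : nat} (P : probability T R).

Lemma Lfun_sum (I : finType) (c : I -> R) (f : I -> T -> R) :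
  (forall i, f i \in Lfun P 2%:E) ->
  (fun w => \sum_i c i * f i w)%R \in Lfun P 2%:E.
Proof.
move=> f2.
rewrite (_ : (fun _ => _) = (\sum_i (c i \o* f i))%R); last first.
  by apply/funext => w; rewrite fct_sumE; apply: eq_bigr => i _; rewrite mulrC.
have p1 : 1 <= 2%:E :> \bar R by rewrite lee_fin ler1n.
by apply: rpred_sum => i _; apply: Lfun_scale => //; rewrite ler1n.
Qed.

Lemma covariance_suml (I : finType) (c : I -> R) (f : I -> T -> R) (g : T -> R) :
  (forall i, f i \in Lfun P 2%:E) -> g \in Lfun P 2%:E ->
  covariance P (fun w => \sum_i c i * f i w)%R g =
  \sum_i (c i)%:E * covariance P (f i) g.
Proof.
move=> f2 g2.
rewrite (_ : (fun _ => _) = (\sum_i (c i \o* f i))%R); last first.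
  by apply/funext => w; rewrite fct_sumE; apply: eq_bigr => i _; rewrite mulrC.
have cf2 i : (c i \o* f i)%R \in Lfun P 2%:E.
  by apply: Lfun_scale => //; rewrite ler1n.
have p1 : 1 <= 2%:E :> \bar R by rewrite lee_fin ler1n.
suff [] : (\sum_i (c i \o* f i))%R \in Lfun P 2%:E /\
  covariance P (\sum_i (c i \o* f i))%R g =
  \sum_i (c i)%:E * covariance P (f i) g by [].
elim/big_rec2: _ => [|i x h _ [h2 IH]].
  split; first exact: rpred0.
  exact: (covariance_cst_l P 0%R g).
split; first exact: rpredD.
rewrite [LHS](@covarianceDl _ _ _ P (c i \o* f i)%R h g)// IH covarianceZl//.
- by apply: Lfun_subset12 => //; exact: fin_num_measure.
- by apply: Lfun_subset12 => //; exact: fin_num_measure.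
- exact: Lfun2_mul_Lfun1.
Qed.

(** Bilinearity of the covariance; square integrable coordinates have finite covariances, so the
    [fine] in [covmx] loses nothing. *)
Lemma variance_dotp (X : T -> 'rV[R]_d) t :
  (forall i, (fun w => X w 0%R i) \in Lfun P 2%:E) ->
  'V_P[fun w => dotp t (X w)] = (varform P X t)%:E.
Proof.
move=> X2.
have cfin i j :
    covariance P (fun w => X w 0%R i) (fun w => X w 0%R j) \is a fin_num.
  apply: covariance_fin_num; rewrite ?Lfun2_mul_Lfun1//;
  by apply: Lfun_subset12 => //; exact: fin_num_measure.
have -> : (fun w => dotp t (X w)) = (fun w => \sum_i t 0 i * X w 0 i)%R.
  by apply/funext => w; rewrite dotpE.
rewrite /variance covariance_suml//; last exact: Lfun_sum.
rewrite /varform /qform -mulmxA mxE -sumEFin; apply: eq_bigr => i _.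
rewrite covarianceC covariance_suml// EFinM; congr (_ * _).
rewrite mxE -sumEFin; apply: eq_bigr => j _.
by rewrite !mxE EFinM fineK// muleC covarianceC.
Qed.

Lemma expectation_dotp (X : T -> 'rV[R]_d) t :
  (forall i, (fun w => X w 0%R i) \in Lfun P 2%:E) -> centered P X ->
  'E_P[fun w => dotp t (X w)] = 0.
Proof.
move=> X2 cX.
have iX i : P.-integrable setT (EFin \o (fun w => X w 0%R i)).
  apply/Lfun1_integrable.
  by apply: Lfun_subset12 => //; exact: fin_num_measure.
have itX i : P.-integrable setT (fun w => (t 0%R i * X w 0%R i)%:E).
  exact: (integrableZl measurableT (t 0%R i) (iX i)).
rewrite unlock; under eq_integral do rewrite dotpE -sumEFin.
rewrite integral_sum//= big1// => i _.
under eq_integral do rewrite EFinM.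
rewrite (integralZl measurableT (iX i)).
by have := cX i; rewrite unlock => ->; rewrite mule0.
Qed.

End covariance_matrix.

(** * Maximum of positive parts *)

Section bigmax_pos.
Context {R : realType} {m : nat}.
Implicit Types (f : 'I_m -> R) (c : R).

Lemma bigmax_pos_ge0 f : 0 <= \big[Num.max/0]_(j < m) Num.max (f j) 0.
Proof. exact: bigmax_ge_id. Qed.

Lemma le_bigmax_pos f j : f j <= \big[Num.max/0]_(j < m) Num.max (f j) 0.
Proof.
apply: le_trans (le_bigmax 0 (fun j => Num.max (f j) 0) j).
by rewrite le_max lexx.
Qed.

Lemma bigmax_pos_le f c : 0 <= c -> (forall j, f j <= c) ->
  \big[Num.max/0]_(j < m) Num.max (f j) 0 <= c.
Proof. by move=> c0 fc; apply: bigmax_le => // j _; rewrite ge_max fc. Qed.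

Lemma bigmax_pos_attained f c :
  0 <= c -> c < \big[Num.max/0]_(j < m) Num.max (f j) 0 -> exists j, c < f j.
Proof.
move=> c0; apply: contraPP => /forallNP h; apply/negP; rewrite -leNgt.
by apply: bigmax_pos_le => // j; rewrite leNgt; apply/negP/h.
Qed.

Lemma bigmax_pos_eq f : 0 < \big[Num.max/0]_(j < m) Num.max (f j) 0 ->
  exists j, f j = \big[Num.max/0]_(j < m) Num.max (f j) 0.
Proof.
set g := \big[Num.max/0]_(j < m) _ => g0.
have /bigmax_geP[|[j _]] : g <= \big[Num.max/0]_(j < m) Num.max (f j) 0 by [].
  by rewrite leNgt g0.
rewrite le_max [g <= 0]leNgt g0 orbF => gj.
by exists j; apply/eqP; rewrite eq_le gj le_bigmax_pos.
Qed.

End bigmax_pos.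

(** * Duality between a polytope and its polar set *)

Section polytope.
Context {R : realType} {d m : nat}.
Variable u : 'I_m -> 'rV[R]_d.
Implicit Type t : 'rV[R]_d.

Let gauge t := \big[Num.max/0]_(j < m) Num.max (dotp t (u j)) 0.

Lemma open_polar : open [set t | forall j, dotp t (u j) < 1].
Proof.
rewrite openE => t /= tu.
apply: (@filter_forall _ _ (fun j => [set s | dotp s (u j) < 1]) (nbhs t)).
move=> j.
have : open (dotp (u j) @^-1` [set y | y < 1]).
  by apply: open_comp; [move=> s _; exact: continuous_dotp|exact: open_lt].
rewrite openE => /(_ t); rewrite /= dotpC => /(_ (tu j)).
by apply: filterS => s /=; rewrite dotpC.
Qed.

(** The set is given by strict inequalities, so the scale [gauge t] itself is not admissible, but
    every larger one is; hence the approximation by [gauge t + e]. *)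
Lemma minkowski_polar t :
  minkowski_functional [set t | forall j, dotp t (u j) < 1] t = (gauge t)%:E.
Proof.
apply/eqP; rewrite eq_le; apply/andP; split; last first.
  apply: le_ereal_inf_tmp => _ [a [a0 [s /= sD <-]] <-].
  rewrite lee_fin; apply: bigmax_pos_le; first exact: ltW.
  by move=> j; rewrite dotpZl ler_piMr// ltW.
apply/lee_addgt0Pr => e e0; apply: ereal_inf_lbound.
have g0 : 0 <= gauge t := bigmax_pos_ge0 _.
have ge0 : 0 < gauge t + e by rewrite ltr_wpDl.
exists (gauge t + e) => //; split => //.
exists ((gauge t + e)^-1 *: t); last by rewrite scalerA divff ?scale1r// gt_eqF.
move=> j /=; rewrite dotpZl ltr_pdivrMl// mulr1.
by rewrite (le_lt_trans (le_bigmax_pos (fun j => dotp t (u j)) j))// ltrDl.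
Qed.

(** The half-space [dotp t x <= gauge t] is convex and contains the generators, hence the hull.
    Conversely, the generator 0 gives a nonnegative supremum, and a positive maximum is approached
    at some [u j]. *)
Lemma support_function_hull t :
  support_function (convex_hull ([set 0] `|` [set u j | j in [set: 'I_m]])) t =
  (gauge t)%:E.
Proof.
set S := _ `|` _.
have SH : S `<=` convex_hull S by exact: sub_gen_smallest.
apply/eqP; rewrite eq_le; apply/andP; split.
  apply: ge_ereal_sup => _ [x Hx <-]; rewrite lee_fin.
  suff : convex_hull S `<=` [set x | dotp t x <= gauge t] by apply.
  apply: smallest_sub.
    move=> y z l; rewrite !inE/= => yS zS.
    rewrite -[X in dotp t X]/(l%:num *: (y : 'rV[R]_d) + (1 - l%:num) *: z).
    rewrite dotpDr !dotpZr.
    have l0 : 0 <= l%:num by [].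
    have l1 : 0 <= 1 - l%:num by rewrite subr_ge0.
    have := lerD (ler_wpM2l l0 yS) (ler_wpM2l l1 zS).
    by rewrite -mulrDl subrKC mul1r.
  move=> y [->|[j _ <-]] /=; first by rewrite dotp0r bigmax_pos_ge0.
  exact: (le_bigmax_pos (fun j => dotp t (u j)) j).
have sup_ge y : S y -> ((dotp t y)%:E <= support_function (convex_hull S) t)%E.
  by move=> Sy; apply: ereal_sup_ubound; exists y => //; exact: SH.
have s0 : (0 <= support_function (convex_hull S) t)%E.
  by have := sup_ge 0; rewrite dotp0r; apply; left.
have [g0|] := eqVneq (gauge t) 0; first by rewrite g0.
rewrite neq_lt ltNge bigmax_pos_ge0/= => g0.
apply/lee_subgt0Pr => e e0.
have [ge|ge] := leP (gauge t - e) 0.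
  by apply: le_trans s0; rewrite -EFinB lee_fin.
have [|j gj] := @bigmax_pos_attained _ _ (fun j => dotp t (u j)) _ (ltW ge).
  by rewrite ltrBlDr ltrDl.
apply: (@le_trans _ _ (dotp t (u j))%:E); first by rewrite -EFinB lee_fin ltW.
by apply: sup_ge; right; exists j.
Qed.

End polytope.

(** * Gaussian plus gamma vectors *)

Section gaussian_mgf.
Local Open Scope ereal_scope.
Context {disp : measure_display} {T : measurableType disp} {R : realType}.
Context {d : nat} (P : probability T R).

Lemma expectation_expRD (a : R) (f : T -> R) : measurable_fun setT f ->
  'E_P[fun w => expR (a + f w)]%R = (expR a)%:E * 'E_P[fun w => expR (f w)]%R.
Proof.
move=> mf; rewrite unlock; under eq_integral do rewrite expRD EFinM.
rewrite ge0_integralZl//.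
by apply/measurable_EFinP; exact: measurableT_comp.
Qed.

(** [moments_of_mgf] wants a cumulant without linear term, so it is applied to [Y - m]. There the
    quadratic formula is exact: the remainder constant is 0 and the radius 1 is arbitrary. *)
Lemma normal_moments (Y : T -> R) (m s : R) : measurable_fun setT Y ->
  (forall B, measurable B -> P (Y @^-1` B) = normal_law m s B) ->
  [/\ Y \in Lfun P 2%:E, 'E_P[Y] = m%:E & 'V_P[Y] = (s ^+ 2)%:E].
Proof.
move=> mY law; pose Y' w := (Y w - m)%R.
have mY' : measurable_fun setT Y' by exact: measurable_funB.
have [] := @moments_of_mgf _ _ _ P Y' (fun r => r ^+ 2 * s ^+ 2 / 2)%R
  (s ^+ 2)%R 0%R 1%R mY' ltr01.
- move=> r _.
  have -> : (fun w => expR (r * Y' w))%R =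
      (fun w => expR (- (r * m) + r * Y w))%R.
    by apply/funext => w; congr expR; rewrite /Y'; ring.
  rewrite expectation_expRD; last exact: measurable_funM.
  by rewrite (normal_mgf _ mY law) -EFinM -expRD; congr (expR _)%:E; ring.
- by move=> r _; rewrite subrr normr0 mulr0.
move=> Y'2 EY' VY'.
have c2 c : cst c \in Lfun P 2%:E by exact: Lfun_cst.
have p1 : 1 <= 2%:E :> \bar R by rewrite lee_fin ler1n.
have L21 f : f \in Lfun P 2%:E -> f \in Lfun P 1.
  by move=> f2; apply: Lfun_subset12 => //; exact: fin_num_measure.
have YE : Y = (Y' \+ cst m)%R by apply/funext => w; rewrite /Y'/= subrK.
split.
- by rewrite YE; apply: rpredD.
- by rewrite YE expectationD ?L21// EY' expectation_cst add0e.
- by rewrite YE varianceD_cst_r.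
Qed.

(** Each functional of [Z] is normal with unknown parameters; centering forces [m = 0], and the
    covariance matrix forces [s ^+ 2] to be the quadratic form. *)
Lemma gaussian_vector_mgf (Z : {RV P >-> borel_rV R d}) :
  gaussian_vector P (Z : T -> 'rV[R]_d) -> centered P (Z : T -> 'rV[R]_d) ->
  forall t, (0 <= varform P (Z : T -> 'rV[R]_d) t)%R /\
    'E_P[fun w => expR (dotp t (Z w))]%R =
      (expR (varform P (Z : T -> 'rV[R]_d) t / 2))%:E.
Proof.
move=> gZ cZ t.
have mZ u : measurable_fun setT (fun w => dotp u (Z w)).
  by apply: (measurableT_comp (measurable_dotp u)); exact: measurable_funP.
have Z2 i : (fun w => (Z w : 'rV[R]_d) 0%R i) \in Lfun P 2%:E.
  have [m [s [_ law]]] := gZ (delta_mx 0%R i).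
  have [+ _ _] := normal_moments (mZ _) law.
  by under eq_fun do rewrite dotp_delta.
have [m [s [_ law]]] := gZ t.
have [_ Em Vs] := normal_moments (mZ t) law.
have m0 : m = 0%R.
  by have := expectation_dotp t Z2 cZ; rewrite Em => -[].
have sV : varform P (Z : T -> 'rV[R]_d) t = (s ^+ 2)%R.
  by have := variance_dotp t Z2; rewrite Vs => -[].
split; first by rewrite sV sqr_ge0.
have := normal_mgf 1 (mZ t) law.
under eq_fun do rewrite mul1r.
by move=> ->; rewrite m0 sV mulr0 add0r expr1n mul1r.
Qed.

End gaussian_mgf.

Section sigma_of_theory.
Context {disp d1 d2 : measure_display} {T : measurableType disp}
  {T1 : measurableType d1} {T2 : measurableType d2}.

(** Makes the exponential factors eligible for the product formula: each is a measurable function of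
    [Z] or of a single [G j]. *)
Lemma sigma_of_comp (Y : T -> T1) (h : T1 -> T2) (B : set T2) :
  measurable_fun setT h -> measurable B -> sigma_of Y ((h \o Y) @^-1` B).
Proof.
move=> mh mB; exists (h @^-1` B); last by rewrite setTI comp_preimage.
by rewrite -[X in measurable X]setTI; exact: mh.
Qed.

End sigma_of_theory.

(** * Cumulant, variance and radial pole *)

Section gamma_convolution.
Context {disp : measure_display} {T : measurableType disp} {R : realType}.
Variables (P : probability T R) (d m : nat).
Variables (Z : {RV P >-> borel_rV R d}) (alpha beta : 'I_m -> R).
Variables (G : 'I_m -> {RV P >-> R}) (v : 'I_m -> 'rV[R]_d).
Hypothesis Zgauss : gaussian_vector P (Z : T -> 'rV[R]_d).
Hypothesis Zcentered : centered P (Z : T -> 'rV[R]_d).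
Hypothesis alpha_gt0 : forall j, 0 < alpha j.
Hypothesis beta_gt0 : forall j, 0 < beta j.
Hypothesis Ggamma : forall j, is_gamma P (alpha j) (beta j) (G j).
Hypothesis indep : independent_systems P (fun k : option 'I_m =>
     if k is Some j then sigma_of (G j) else sigma_of Z).

Let A : 'M[R]_d := covmx P (Z : T -> 'rV[R]_d).
Let X : T -> 'rV[R]_d := fun w =>
  (Z w : 'rV[R]_d) + \sum_(j < m) (G j w - alpha j * beta j) *: v j.
Let x t j := beta j * dotp t (v j).
Let kappa t := 2^-1 * qform A t +
  \sum_(j < m) alpha j * (- ln (1 - x t j) - x t j).

Let mX t : measurable_fun setT (fun w => dotp t (X w)).
Proof.
under eq_fun do rewrite dotpDr dotp_sumr.
apply: measurable_funD.
  by apply: (measurableT_comp (measurable_dotp t)); exact: measurable_funP.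
apply: measurable_sum => j; under eq_fun do rewrite dotpZr.
by apply: measurable_funM => //; exact: measurable_funB.
Qed.

(** The factors are indexed by [option 'I_m] as in [indep], with [None] for the Gaussian part.
    Subtracting the mean of [G j] produces the term [- x t j]. *)
Lemma mgf_gamma_convolution t : (forall j, x t j < 1) ->
  ('E_P[fun w => expR (dotp t (X w))]%R = (expR (kappa t))%:E)%E.
Proof.
move=> xt.
pose h (k : option 'I_m) : T -> R :=
  if k is Some j then fun w => expR (dotp t (v j) * (G j w - alpha j * beta j))
  else fun w => expR (dotp t (Z w)).
have mZ : measurable_fun setT (fun w => dotp t (Z w)).
  by apply: (measurableT_comp (measurable_dotp t)); exact: measurable_funP.
have Eh k : ('E_P[h k] = (expR (if k is Some j
    then alpha j * (- ln (1 - x t j) - x t j) else 2^-1 * qform A t))%:E)%E.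
  case: k => [j|] /=; last first.
    by have [_ ->] := gaussian_vector_mgf Zgauss Zcentered t; rewrite mulrC.
  have -> : (fun w => expR (dotp t (v j) * (G j w - alpha j * beta j))) =
    (fun w => expR (- (alpha j * x t j) + dotp t (v j) * G j w)).
    by apply/funext => w; congr expR; rewrite /x; ring.
  rewrite expectation_expRD; last by apply: measurable_funM.
  rewrite (gamma_mgf _ (beta_gt0 j) (Ggamma j) (xt j))//.
  by rewrite -EFinM -expRD; congr (expR _)%:E; rewrite /x; ring.
have -> : (fun w => expR (dotp t (X w))) = (fun w => \prod_k h k w).
  apply/funext => w; rewrite dotpDr dotp_sumr expRD expR_sum.
  rewrite (bigD1 None)//=; congr (_ * _).
  rewrite (reindex_omap Some id)//=; last by case.
  apply: eq_big => [j|j _]; first by rewrite eqxx.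
  by rewrite dotpZr mulrC.
rewrite (@expectation_prod_independent _ _ _ P _ _ h indep).
- under eq_bigr do rewrite Eh.
  rewrite prodEFin -expR_sum; congr (expR _)%:E.
  rewrite (bigD1 None)//=; congr (_ + _).
  rewrite (reindex_omap Some id)//=; last by case.
  by apply: eq_big => [j|//]; rewrite eqxx.
- case=> [j|] /=; apply: measurableT_comp => //.
  by apply: measurable_funM => //; exact: measurable_funB.
- by move=> [j|] w /=; exact: expR_ge0.
- case=> [j|] B mB /=.
    apply: (@sigma_of_comp _ _ _ _ _ _ (G j)
      (fun y => expR (dotp t (v j) * (y - alpha j * beta j)))) => //.
    apply: measurableT_comp => //; apply: measurable_funM => //.
    exact: measurable_funB.
  apply: (@sigma_of_comp _ _ _ _ _ _ Z (expR \o dotp t)) => //.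
  by apply: measurableT_comp => //; exact: measurable_dotp.
- by move=> k; rewrite Eh ltry.
Qed.

Let xZ r t j : x (r *: t) j = r * x t j.
Proof. by rewrite /x dotpZl; ring. Qed.

Let gamma_convolution_moments t :
  [/\ (fun w => dotp t (X w)) \in Lfun P 2%:E,
      ('E_P[fun w => dotp t (X w)] = 0)%E &
      ('V_P[fun w => dotp t (X w)] =
        (qform A t + \sum_(j < m) alpha j * x t j ^+ 2)%:E)%E].
Proof.
have S0 : 0 <= \sum_j `|x t j| by exact: sumr_ge0.
(* For |r| <= [delta] every [r * x t j] is at most 1/2 in absolute value: this keeps [r *: t] in the
   domain and is the range of [ln1B_taylor]. *)
pose delta := (2 * (1 + \sum_j `|x t j|))^-1.
have delta0 : 0 < delta by rewrite invr_gt0 mulr_gt0// ltr_wpDr.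
have small r j : `|r| <= delta -> `|r * x t j| <= 2^-1.
  move=> rd; rewrite normrM (le_trans (ler_wpM2r (normr_ge0 _) rd))//.
  rewrite /delta invfM -mulrA ger_pMr// mulrC ler_pdivrMr ?mul1r ?ltr_wpDr//.
  by rewrite (bigD1 j)//= addrCA lerDl addr_ge0// sumr_ge0.
apply: (@moments_of_mgf _ _ _ P (fun w => dotp t (X w)) (fun r => kappa (r *: t))
  _ (\sum_(j < m) alpha j * `|x t j| ^+ 3) delta) => //.
- move=> r rd; have := @mgf_gamma_convolution (r *: t).
  under eq_fun do rewrite dotpC dotpZr dotpC.
  apply => j; rewrite xZ; apply: le_lt_trans (ler_norm _) _.
  by apply: le_lt_trans (small _ _ rd) _; rewrite invf_lt1// ltr1n.
- move=> r rd.
  have -> : kappa (r *: t) -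
      r ^+ 2 * (qform A t + \sum_(j < m) alpha j * x t j ^+ 2) / 2 =
      \sum_(j < m) alpha j * (- ln (1 - r * x t j) - r * x t j
        - (r * x t j) ^+ 2 / 2).
    rewrite /kappa qformZ mulrDr mulrDl opprD addrACA.
    (* The Gaussian part is exactly quadratic in [r] and cancels; only the gamma terms leave a cubic
       error. *)
    rewrite (_ : _ - _ = 0) ?add0r; last by lra.
    rewrite mulr_sumr mulr_suml -sumrB; apply: eq_bigr => j _.
    by rewrite xZ; field.
  rewrite mulr_sumr (le_trans (ler_norm_sum _ _ _))//.
  apply: ler_sum => j _; rewrite normrM (gtr0_norm (alpha_gt0 j)).
  rewrite [leRHS]mulrCA ler_pM2l//.
  by rewrite -exprMn -normrM ln1B_taylor// small.
Qed.

(** The scalar moments are used at [t] for the variance, and at the basis vectors for the square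
    integrability that [variance_dotp] requires. *)
Lemma variance_gamma_convolution t :
  varform P X t = qform A t + \sum_(j < m) alpha j * x t j ^+ 2.
Proof.
have [_ _ Vt] := gamma_convolution_moments t.
apply: EFin_inj; rewrite -Vt variance_dotp// => i.
have [+ _ _] := gamma_convolution_moments (delta_mx 0 i).
by under eq_fun do rewrite dotp_delta.
Qed.

Lemma qform_ge0 t : 0 <= qform A t.
Proof. by have [] := gaussian_vector_mgf Zgauss Zcentered t. Qed.

Lemma cumulant_fin t : (forall j, x t j < 1) -> cumulant P X t = (kappa t)%:E.
Proof.
by move=> xt; rewrite /cumulant mgf_gamma_convolution// lne_EFin ?expR_gt0// expRK.
Qed.


(* Were the expectation finite at [t], it would bound the explicit formula along
   the segment from 0 to the pole of the ray through [t], where it blows up. *)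
Lemma cumulant_infty t j0 : 1 <= x t j0 -> cumulant P X t = +oo%E.
Proof.
move=> xj0; pose g := \big[Num.max/0]_(j < m) Num.max (x t j) 0.
have gx j : x t j <= g by exact: (le_bigmax_pos (fun j => x t j) j).
have g1 : 1 <= g by apply: le_trans xj0 (gx _).
have g0 : 0 < g by apply: lt_le_trans ltr01 g1.
have [j1 xj1] : exists j, x t j = g.
  exact: (@bigmax_pos_eq _ _ (fun j => x t j)).
suff : ('E_P[fun w => expR (dotp t (X w))]%R = +oo)%E by rewrite /cumulant => ->.
apply/eqP; rewrite -leye_eq leNgt; apply/negP => Efin.
have Eint : P.-integrable setT (EFin \o (fun w => expR (dotp t (X w)))).
  apply/integrableP; split.
    by apply/measurable_EFinP; exact: measurableT_comp.
  under eq_integral do rewrite /= ger0_norm ?expR_ge0//.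
  by rewrite unlock in Efin.
pose M := fine ('E_P[fun w => expR (dotp t (X w))]%R)%E.
have M0 : 0 <= M by apply: fine_ge0; apply: expectation_ge0 => w; exact: expR_ge0.
have EM : ('E_P[fun w => expR (dotp t (X w))]%R = M%:E)%E.
  by rewrite fineK// ge0_fin_numE// expectation_ge0// => w; exact: expR_ge0.
have a0 := alpha_gt0 j1.
(* At the point where [x] is [1 - expR (- y)] in the coordinate [j1], the singular term is at least
   [alpha j1 * (y - 1)], which is [M + alpha j1]. Finiteness at [t] will give [expR kappa <= 1 + M],
   hence [kappa <= M]. *)
pose y := M / alpha j1 + 2.
have y2 : 0 < y by rewrite ltr_wpDl// divr_ge0// ltW.
pose e := expR (- y).
have e0 : 0 < e by exact: expR_gt0.
have e1 : e < 1 by rewrite expR_lt1 oppr_lt0.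
pose s := (1 - e) / g.
have s0 : 0 <= s by rewrite divr_ge0 ?ltW// subr_gt0.
have s1 : s <= 1 by rewrite ler_pdivrMr// mul1r; lra.
have sx j : x (s *: t) j <= 1 - e.
  by rewrite xZ /s mulrAC ler_pdivrMr// ler_wpM2l// subr_ge0 ltW.
have sx1 j : x (s *: t) j < 1 by apply: le_lt_trans (sx j) _; lra.
(* For [0 <= s <= 1], exp (s z) is at most exp z or at most 1, according to the sign of z. *)
have le1 : ('E_P[fun w => expR (dotp (s *: t) (X w))]%R <= (1 + M)%:E)%E.
  rewrite EFinD -EM -(@expectation_cst _ _ _ P 1) -expectationD; last 2 first.
  - exact: Lfun_cst.
  - exact/Lfun1_integrable.
  apply: expectation_le => //.
  - by apply: measurableT_comp.
  - by apply: measurable_funD => //; apply: measurableT_comp.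
  - by move=> w /=; rewrite addr_ge0// expR_ge0.
  - apply: aeW => w /=; rewrite dotpZl.
    have [z0|/ltW z0] := leP 0 (dotp t (X w)).
      by apply: le_trans (_ : expR (dotp t (X w)) <= _);
        [rewrite ler_expR ler_piMl|rewrite lerDr].
    apply: le_trans (_ : 1 <= _); last by rewrite lerDl expR_ge0.
    by rewrite expR_le1 mulr_ge0_le0.
rewrite (mgf_gamma_convolution sx1) lee_fin in le1.
have : alpha j1 * (y - 1) <= kappa (s *: t).
  rewrite /kappa (bigD1 j1)//= addrCA.
  have h1 : 0 <= \sum_(j < m | j != j1)
      alpha j * (- ln (1 - x (s *: t) j) - x (s *: t) j).
    apply: sumr_ge0 => j _; apply: mulr_ge0; first exact: ltW.
    exact: ln1B_nneg.
  have h2 : 0 <= 2^-1 * qform A (s *: t) by rewrite mulr_ge0// qform_ge0.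
  apply: ler_wpDr; first exact: addr_ge0.
  rewrite ler_pM2l//.
  have -> : x (s *: t) j1 = 1 - e by rewrite xZ xj1 /s divfK// gt_eqF.
  by rewrite subKr expRK opprK; lra.
have := expR_ge1Dx (kappa (s *: t)).
have -> : alpha j1 * (y - 1) = M + alpha j1 by rewrite /y; field; rewrite gt_eqF.
by move: le1 a0; lra.
Qed.

Lemma cumulant_lty t : (cumulant P X t < +oo)%E <-> forall j, x t j < 1.
Proof.
split=> [|/cumulant_fin ->]; last by rewrite ltry.
by apply: contraPP => /existsNP[j /negP]; rewrite -leNgt => /cumulant_infty ->.
Qed.

(** The effective domain is already open, so passing to its interior changes nothing. *)
Lemma cumulant_domainE : cumulant_domain P X = [set t | forall j, x t j < 1].
Proof.
rewrite /cumulant_domain (_ : mkset _ = [set t | forall j, x t j < 1]); last first.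
  by apply/seteqP; split=> t /cumulant_lty.
apply/interior_id.
rewrite (_ : mkset _ = [set t | forall j, dotp t (beta j *: v j) < 1]).
  exact: open_polar.
by apply/seteqP; split=> t /= h j; have := h j; rewrite dotpZr.
Qed.

Lemma radial_poleE t :
  radial_pole P X t = (\big[Num.max/0]_(j < m) Num.max (x t j) 0)%:E.
Proof.
set g := \big[Num.max/0]_(j < m) _.
have gx j : x t j <= g by exact: (le_bigmax_pos (fun j => x t j) j).
have g0 : 0 <= g by exact: bigmax_pos_ge0.
have sq0 j : 0 <= alpha j * x t j ^+ 2 by rewrite mulr_ge0 ?sqr_ge0// ltW.
rewrite /radial_pole variance_gamma_convolution; case: ifPn => [V0|]; last first.
  (* Zero variance forces every [x t j] to vanish, so the maximum agrees with the conventional value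
     0 of the pole. *)
  rewrite -leNgt => V0; congr EFin; apply/esym/eqP; rewrite eq_le g0 andbT.
  apply: bigmax_pos_le => // j.
  have : alpha j * x t j ^+ 2 <= 0.
    apply: le_trans V0; rewrite (bigD1 j)//= addrCA lerDl addr_ge0 ?qform_ge0//.
    exact: sumr_ge0.
  rewrite pmulr_rle0// => h.
  by have : x t j ^+ 2 == 0; [rewrite eq_le h sqr_ge0|rewrite sqrf_eq0 => /eqP ->].
apply/eqP; rewrite eq_le; apply/andP; split.
  apply: ereal_inf_lbound; exists g => //; split => // s s0 sg.
  have gs1 : g * s < 1.
    (* For [g = 0] the inverse is [+oo] and [s] is unrestricted, but [g * s] is then 0. *)
    have [->|gn0] := eqVneq g 0; first by rewrite mul0r.
    have gp : 0 < g by rewrite lt_neqAle eq_sym gn0.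
    by move: sg; rewrite inver (negbTE gn0) lte_fin -ltr_pdivlMl// mulr1.
  have gs0 : 0 <= g * s by exact: mulr_ge0.
  have xs j : x (s *: t) j <= g * s by rewrite xZ mulrC ler_wpM2r.
  rewrite cumulant_fin ?lee_fin; last by move=> j; exact: le_lt_trans (xs j) gs1.
  have mulDD (a b c e : R) : (a + b) * c / e = a * c / e + b * c / e.
    by rewrite -mulrDl -mulrDl.
  (* The bound splits along the variance: the Gaussian half uses only [1 <= (1 - g * s)^-1], and
     each gamma term uses [ln1B_ub] with the common value [c = g * s]. *)
  rewrite /kappa qformZ mulDD lerD//.
    rewrite [leRHS](_ : _ = (1 - g * s)^-1 * (2^-1 * (s ^+ 2 * qform A t))).
      rewrite ler_peMl ?mulr_ge0 ?sqr_ge0 ?qform_ge0//.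
      by rewrite invf_ge1; lra.
    by rewrite invfM; ring.
  rewrite !mulr_suml; apply: ler_sum => j _.
  have -> : alpha j * x t j ^+ 2 * s ^+ 2 / (2 * (1 - g * s)) =
      alpha j * (x (s *: t) j ^+ 2 / (2 * (1 - g * s))).
    rewrite xZ; move: (x t j) ((2 * (1 - g * s))^-1) => y z; ring.
  by rewrite ler_pM2l// ln1B_ub.
apply: le_ereal_inf_tmp => _ [c [c0 hc] <-]; rewrite lee_fin leNgt.
apply/negP => cg.
have [j xj] := bigmax_pos_attained c0 cg.
have xj0 : 0 < x t j by exact: le_lt_trans xj.
have xc : ((x t j)^-1%:E < c%:E^-1)%E.
  rewrite inver; case: eqVneq => [_|cn0]; first by rewrite ltry.
  by rewrite lte_fin ltf_pV2// posrE lt_neqAle eq_sym cn0.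
have := hc (x t j)^-1; rewrite invr_ge0 (ltW xj0) => /(_ isT xc).
rewrite (@cumulant_infty _ j); last by rewrite xZ mulVf// gt_eqF.
by rewrite leye_eq.
Qed.

End gamma_convolution.

Theorem theorem5p1 (disp : measure_display) (T : measurableType disp)
  (R : realType) (P : probability T R) (d m : nat)
  (A : 'M[R]_d) (Z : {RV P >-> borel_rV R d})
  (alpha beta : 'I_m -> R) (G : 'I_m -> {RV P >-> R})
  (v : 'I_m -> 'rV[R]_d)
  (Zgauss : gaussian_vector P (Z : T -> 'rV[R]_d))
  (Zcentered : centered P (Z : T -> 'rV[R]_d))
  (Zcov : covmx P (Z : T -> 'rV[R]_d) = A)
  (alpha_gt0 : forall j, 0 < alpha j)
  (beta_gt0 : forall j, 0 < beta j)
  (Ggamma : forall j, is_gamma P (alpha j) (beta j) (G j))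
  (indep : independent_systems P (fun k : option 'I_m =>
     if k is Some j then sigma_of (G j) else sigma_of Z)) :
  let X : T -> 'rV[R]_d := fun w =>
    (Z w : 'rV[R]_d) + \sum_(j < m) (G j w - alpha j * beta j) *: v j in
  let D : set 'rV[R]_d := cumulant_domain P X in
  let Pol : set 'rV[R]_d :=
    convex_hull ([set 0] `|` [set beta j *: v j | j in [set: 'I_m]]) in
  [/\ D = [set t | forall j, beta j * dotp t (v j) < 1],
      forall t, D t ->
        cumulant P X t =
          (2^-1 * qform A t + \sum_(j < m) alpha j *
             (- ln (1 - beta j * dotp t (v j)) - beta j * dotp t (v j)))%:E,
      forall t,
        radial_pole P X t =
          (\big[Num.max/0]_(j < m) Num.max (beta j * dotp t (v j)) 0)%:E /\
        (\big[Num.max/0]_(j < m) Num.max (beta j * dotp t (v j)) 0)%:E =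
          minkowski_functional D t
    & forall t, radial_pole P X t = support_function Pol t].
Proof.
move: Zcov => <- X D Pol.
have DE : D = [set t | forall j, beta j * dotp t (v j) < 1].
  exact: (cumulant_domainE v Zgauss Zcentered alpha_gt0 beta_gt0 Ggamma indep).
have DE' : D = [set t | forall j, dotp t (beta j *: v j) < 1].
  by rewrite DE; apply/seteqP; split=> t /= h j; have := h j; rewrite dotpZr.
have gaugeE t : \big[Num.max/0]_(j < m) Num.max (beta j * dotp t (v j)) 0 =
    \big[Num.max/0]_(j < m) Num.max (dotp t (beta j *: v j)) 0.
  by apply: eq_bigr => j _; rewrite dotpZr.
have pole := radial_poleE v Zgauss Zcentered alpha_gt0 beta_gt0 Ggamma indep.
split=> // [t|t|t].
- rewrite DE => tD.
  exact: (cumulant_fin Zgauss Zcentered beta_gt0 Ggamma indep).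
- by split; [exact: pole|rewrite gaugeE DE' minkowski_polar].
- by rewrite pole gaugeE support_function_hull.
Qed.
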